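(* Every upcycle has the partial words balance property. That is, if $u$ is an upcycle for $A^n$, then there is a nonnegative integer $k$ such that each letter of $A$ appears exactly $k$ times in $u$.
   Context: Let $A$ be an alphabet with $|A|\ge 2$ letters and $\diamond\notin A$ a wildcard symbol (''diamond''). A partial word is a finite sequence over $A\cup\{\diamond\}$; a cyclic partial word $u=(u_1\cdots u_N)$ is cyclically ordered, with indices taken modulo $N$. A partial word $x$ covers a word $y$ of the same length if for each $i$ either $x_i=\diamond$ or $x_i=y_i$. For $n\ge 1$, an upcycle for $A^n$ is a cyclic partial word $u=(u_1\cdots u_N)$ such that for each word $y\in A^n$ there is exactly one position $i\in\{1,\dots,N\}$ such that the window $u_i\cdots u_{i+n-1}$ covers $y$. A letter $\ell\in A$ appears in $u$ at position $i$ if $u_i=\ell$ (diamonds do not count as appearances of letters). *)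

(* Defs.v *)
From mathcomp Require Import all_boot.

Set Implicit Arguments.
Unset Strict Implicit.
Unset Printing Implicit Defensive.

(* A partial word over A is a sequence over [option A]: [Some a] is the
   letter a and [None] is the wildcard symbol. *)
Definition diamond {A : Type} : option A := None.

Definition covers (A : eqType) (n : nat) (x : n.-tuple (option A))
    (y : n.-tuple A) : bool :=
  [forall j : 'I_n, (tnth x j == diamond) || (tnth x j == Some (tnth y j))].

(* A cyclic partial word of length N is represented by one of its linear
   readings, positions being numbered 0, ..., N - 1.  The window length n may
   exceed N, in which case the window wraps around the cycle.  The default
   value of [nth] is never used, since a position i : 'I_N forces 0 < N. *)
Definition window (A : Type) (N n : nat) (u : N.-tuple (option A)) (i : 'I_N) :
    n.-tuple (option A) :=
  [tuple nth diamond u ((i + j) %% N) | j < n].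

Definition upcycle (A : eqType) (n N : nat) (u : N.-tuple (option A)) : Prop :=
  forall y : n.-tuple A, exists! i : 'I_N, covers (window n u i) y.

Definition appearances (A : eqType) (N : nat) (u : N.-tuple (option A))
    (a : A) : nat :=
  #|[set i : 'I_N | tnth u i == Some a]|.

Definition balanced (A : eqType) (N : nat) (u : N.-tuple (option A)) : Prop :=
  exists k : nat, forall a : A, appearances u a = k.

(* Main.v *)
Require Import Defs.
From mathcomp Require Import all_boot.

(** If u_i is a diamond while u_(i+n) is a letter, pick a letter b different
    from u_(i+n) and a word v covered by u_(i+1) ... u_(i+n-1).  The window
    covering v b starts at some k, and u_(k-1) ... u_(k+n-2) covers x v for some
    letter x; since the window at i covers x v too, uniqueness gives k = i + 1,
    which is absurd because u_(i+n) does not cover b.  Hence the diamonds are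
    n-periodic and all windows contain the same number D of diamonds.  Counting
    the words with first letter a by the window covering them gives
    q^(n-1) = (number of a in u) * q^D + K, where q = |A| and K, the contribution
    of the windows starting with a diamond, does not depend on a. *)

Definition fits {A : eqType} (o : option A) (a : A) : bool :=
  (o == diamond) || (o == Some a).

Definition cyc {A : Type} {N : nat} (u : N.-tuple (option A)) (k : nat) :
    option A :=
  nth diamond u (k %% N).

Definition window_diamonds {A : eqType} (n : nat) {N : nat}
    (u : N.-tuple (option A)) (i : nat) : nat :=
  \sum_(j < n) (cyc u (i + j) == diamond).

Lemma fits_odflt (A : eqType) (b : A) (o : option A) : fits o (odflt b o).
Proof. by case: o => [x|]; rewrite /fits ?eqxx ?orbT. Qed.

(** The Boolean exponent lets a product over positions collapse to a power of [#|A|] whose exponent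
    counts diamonds. *)
Lemma card_fits (A : finType) (o : option A) :
  #|fits o| = #|A| ^ (o == diamond).
Proof.
case: o => [x|].
  by rewrite expn0 -(card1 x); apply: eq_card => z; rewrite !inE /fits /= eq_sym.
by rewrite expn1; apply: eq_card => z; rewrite !inE.
Qed.

Lemma exists_neq (A : finType) (x : A) : 2 <= #|A| -> exists b : A, b != x.
Proof.
move=> hA; apply/existsP; apply: contraTT hA => /existsPn H.
rewrite -ltnNge ltnS -(card1 x); apply/subset_leq_card/subsetP => z _.
by rewrite inE; move: (H z); rewrite negbK.
Qed.

Lemma cyc_mod {A : Type} {N : nat} (u : N.-tuple (option A)) (k l : nat) :
  k = l %[mod N] -> cyc u k = cyc u l.
Proof. by rewrite /cyc => ->. Qed.

Lemma covers_windowE (A : eqType) (n N : nat) (u : N.-tuple (option A))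
    (i : 'I_N) (y : n.-tuple A) :
  covers (window n u i) y = [forall j : 'I_n, fits (cyc u (i + j)) (tnth y j)].
Proof. by apply: eq_forallb => j; rewrite tnth_mktuple. Qed.

Section Upcycle.

Context {A : finType} {m N : nat} {u : N.+1.-tuple (option A)}.
Hypothesis hu : upcycle m.+1 u.

(** Words are read off functions on [nat], so that shifting or extending one needs no casts between
    tuples. *)
Lemma upcycle_unique (g : nat -> A) (k l : nat) :
    (forall j, j < m.+1 -> fits (cyc u (k + j)) (g j)) ->
    (forall j, j < m.+1 -> fits (cyc u (l + j)) (g j)) ->
  k = l %[mod N.+1].
Proof.
have [i [_ ui]] := hu [tuple g j | j < m.+1].
have P r : (forall j, j < m.+1 -> fits (cyc u (r + j)) (g j)) ->
    i = r %% N.+1 :> nat.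
  move=> H; suff -> : i = inord (r %% N.+1) by rewrite inordK ?ltn_pmod.
  apply: ui; rewrite covers_windowE; apply/forallP => j.
  rewrite tnth_mktuple inordK ?ltn_pmod // (@cyc_mod _ _ _ _ (r + j)) ?modnDml //.
  exact: H.
by move=> /P <- /P <-.
Qed.

Lemma upcycle_exists (g : nat -> A) :
  exists k, forall j, j < m.+1 -> fits (cyc u (k + j)) (g j).
Proof.
have [i [+ _]] := hu [tuple g j | j < m.+1].
rewrite covers_windowE => /forallP H; exists i => j lt_j.
by have := H (Ordinal lt_j); rewrite tnth_mktuple.
Qed.

Lemma upcycle_diamond_next (i : nat) :
  2 <= #|A| -> cyc u i = diamond -> cyc u (i + m.+1) = diamond.
Proof.
move=> hA ui; case Ex: (cyc u (i + m.+1)) => [x|] //.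
have [b neq_bx] := exists_neq _ x hA.
(* This is the word v b, with [b] also filling the diamonds of v. *)
pose g j := if j < m then odflt b (cyc u (i + j.+1)) else b.
have [k Hk] := upcycle_exists g.
(* This is the word x v; [k + N] stands for k - 1 modulo [N.+1], which avoids truncated
   subtraction. *)
pose h j := if j is j'.+1 then g j' else odflt b (cyc u (k + N)).
have eq_ki : k + N = i %[mod N.+1].
  apply: (upcycle_unique h) => -[|j] lt_j /=.
  - by rewrite addn0 fits_odflt.
  - rewrite (@cyc_mod _ _ _ _ (k + j)); first exact/Hk/ltnW.
    by rewrite addnAC -addnA addSnnS addnA modnDr.
  - by rewrite addn0 ui.
  - by rewrite /g -ltnS lt_j fits_odflt.
(* The last position of the window at [k] is now [i + m.+1], whose letter [x] would have to be
   [b]. *)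
have := Hk m (ltnSn m); rewrite /g ltnn (@cyc_mod _ _ _ _ (i + m.+1)).
  by rewrite Ex /fits /= => /eqP [E]; rewrite E eqxx in neq_bx.
by rewrite -[RHS]modnDml -eq_ki modnDml addnAC addnS addSn -addnS modnDr.
Qed.

Lemma upcycle_diamond_periodic (i : nat) :
  2 <= #|A| -> (cyc u (i + m.+1) == diamond) = (cyc u i == diamond).
Proof.
move=> hA; apply/eqP/eqP => [H|]; last exact: upcycle_diamond_next.
(* Going backwards is going forwards around the cycle: [N.+1] shifts by [m.+1] lead back to [i]. *)
have Ht t : cyc u (i + t.+1 * m.+1) = diamond.
  elim: t => [|t IHt]; first by rewrite mul1n.
  by rewrite mulSnr addnA; apply: upcycle_diamond_next.
by rewrite -(Ht N); apply: cyc_mod; rewrite addnC mulnC modnMDl.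
Qed.

(** Sliding the window by one position drops [cyc u i] and gains [cyc u (i + m.+1)], which are
    diamonds simultaneously. *)
Lemma upcycle_window_diamonds (i : nat) :
  2 <= #|A| -> window_diamonds m.+1 u i = window_diamonds m.+1 u 0.
Proof.
move=> hA; elim: i => // i <-; rewrite /window_diamonds big_ord_recr big_ord_recl.
rewrite /= addn0 addSnnS upcycle_diamond_periodic // addnC; congr (_ + _).
by apply: eq_bigr => j _; rewrite addSnnS.
Qed.

Lemma card_covered_head (a : A) (i : nat) :
  #|[set y : {ffun 'I_m.+1 -> A} | (y ord0 == a) &&
      [forall j : 'I_m.+1, fits (cyc u (i + j)) (y j)]]| =
  fits (cyc u i) a * #|A| ^ (\sum_(j < m) (cyc u (i + j.+1) == diamond)).
Proof.
(* The conditions on [y] are independent across positions, so the count is a product of the sizes of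
   the [F j]. *)
pose F (j : 'I_m.+1) : {pred A} :=
  [pred z | ((j == ord0) ==> (z == a)) && fits (cyc u (i + j)) z].
transitivity #|family F|.
  apply: eq_card => y; rewrite inE; apply/andP/familyP => [[/eqP ya /forallP H] j|H].
    by rewrite inE H andbT; apply/implyP => /eqP ->; rewrite ya.
  have := H ord0; rewrite inE /= => /andP [-> _]; split=> //.
  by apply/forallP => j; have := H j; rewrite inE => /andP [].
rewrite card_family foldrE big_map enumT -/(index_enum _) big_ord_recl; congr (_ * _).
  case E: (fits (cyc u i) a).
    rewrite -[RHS](card1 a); apply: eq_card => z; rewrite !inE /= addn0.
    by case: eqP => // ->; rewrite E.
  apply: eq_card0 => z; rewrite !inE /= addn0.
  by case: eqP => // ->; rewrite E.
rewrite expn_sum; apply: eq_bigr => j _.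
by rewrite -card_fits; apply: eq_card => z; rewrite !inE.
Qed.

Lemma card_head (a : A) :
  #|[set y : {ffun 'I_m.+1 -> A} | y ord0 == a]| = #|A| ^ m.
Proof.
pose F (j : 'I_m.+1) : {pred A} := [pred z | (j == ord0) ==> (z == a)].
transitivity #|family F|.
  apply: eq_card => y; rewrite inE; apply/idP/familyP => [ya j|/(_ ord0)].
    by rewrite inE; apply/implyP => /eqP ->.
  by rewrite inE.
rewrite card_family foldrE big_map enumT -/(index_enum _) big_ord_recl.
rewrite (@eq_card _ _ (pred1 a)) ?card1 ?mul1n; last by move=> z; rewrite !inE.
rewrite (eq_bigr (fun=> #|A|)) ?prod_nat_const ?card_ord //.
Qed.

Lemma upcycle_head_count (a : A) :
  \sum_(i < N.+1) #|[set y : {ffun 'I_m.+1 -> A} | (y ord0 == a) &&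
      [forall j : 'I_m.+1, fits (cyc u (i + j)) (y j)]]| = #|A| ^ m.
Proof.
under eq_bigr => i _ do rewrite -sum1dep_card big_mkcondr.
(* Double counting: after the exchange, each word with head [a] contributes 1, for the only window
   covering it. *)
rewrite exchange_big -(card_head a) -sum1dep_card; apply: eq_bigr => y _ /=.
have [i [ci ui]] := hu [tuple y j | j < m.+1].
have E (l : 'I_N.+1) : [forall j : 'I_m.+1, fits (cyc u (l + j)) (y j)] = (l == i).
  transitivity (covers (window m.+1 u l) [tuple y j | j < m.+1]).
    by rewrite covers_windowE; apply: eq_forallb => j; rewrite tnth_mktuple.
  by apply/idP/eqP => [/ui ->|->].
by under eq_bigr => l _ do rewrite E; rewrite -big_mkcond big_pred1_eq.
Qed.

Lemma upcycle_appearances (a : A) : 2 <= #|A| ->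
  appearances u a * #|A| ^ window_diamonds m.+1 u 0 +
    \sum_(i < N.+1 | cyc u i == diamond)
      #|A| ^ (\sum_(j < m) (cyc u (i + j.+1) == diamond)) = #|A| ^ m.
Proof.
move=> hA; rewrite -(upcycle_head_count a) /appearances -sum1dep_card big_distrl /=.
rewrite big_mkcond [X in _ + X]big_mkcond -big_split; apply: eq_bigr => i _ /=.
rewrite card_covered_head -(upcycle_window_diamonds i) // /window_diamonds.
rewrite big_ord_recl /= addn0.
have -> : tnth u i = cyc u i by rewrite (tnth_nth diamond) /cyc modn_small.
(* A window starting with a letter has all its diamonds in the tail, and contributes only if that
   letter is [a]. *)
case: (cyc u i) => [x|]; rewrite /fits /= ?mul1n ?addn0 //.
by case: (_ == _); rewrite ?mul1n ?mul0n.
Qed.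

End Upcycle.

Theorem theorem7p8 (A : finType) (hA : 2 <= #|A|) (n : nat) (hn : 1 <= n)
    (N : nat) (u : N.-tuple (option A)) (hu : upcycle n u) :
  balanced u.
Proof.
case: n hn hu => // m _ hu.
have /card_gt0P [a0 _] : 0 < #|A| by exact: ltnW.
(* An empty cycle has no window to cover the constant word [a0]. *)
case: N u hu => [|N] u hu; first by have [[]] := hu [tuple a0 | _ < m.+1].
exists (appearances u a0) => a; apply/eqP.
rewrite -(@eqn_pmul2r (#|A| ^ window_diamonds m.+1 u 0)) ?expn_gt0 ?(ltnW hA) //.
have := upcycle_appearances hu a hA; rewrite -(upcycle_appearances hu a0 hA).
by move/addIn => ->.
Qed.
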